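(* Let $G$ be a weighted $($not necessarily planar$)$ graph. Let $a$, $b$, $c$ and $d$ be four arbitrary, distinct vertices of $G$. Assume that for all two-element subsets $S\subset\{a,b,c,d\}$, all paths connecting $a$ to $b$, $a$ to $c$, or $b$ to $c$ that arise from the superposition of any perfect matching $\mu$ of $G\setminus S$ with any perfect matching $\nu$ of $G\setminus\overline{S}$ have odd length, where $\overline{S}$ denotes the complement of $S$ in $\{a,b,c,d\}$. Then \begin{align*} &\operatorname{M}(G)\operatorname{M}(G\setminus\{a,b,c,d\}) = \operatorname{M}(G\setminus\{a,b\})\operatorname{M}(G\setminus\{c,d\}) + \operatorname{M}(G\setminus\{a,c\})\operatorname{M}(G\setminus\{b,d\}) \\ &\qquad\qquad+ \operatorname{M}(G\setminus\{a,d\})\operatorname{M}(G\setminus\{b,c\}). \end{align*}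
   Context: For a graph $G$ with weights on its edges, $\operatorname{M}(G)$ denotes the sum of the weights of all perfect matchings of $G$, where the weight of a matching is the product of the weights of its edges. *)

(* Defs.v *)
From mathcomp Require Import all_boot all_order all_algebra.

Set Implicit Arguments.
Unset Strict Implicit.
Unset Printing Implicit Defensive.

Import GRing.Theory.
Local Open Scope ring_scope.

(* The vertices form a finite set [vset] inside an ambient finite type, so that
   deleting vertices stays within the same type; an edge is a set of two
   vertices, and the values of [wt] outside [eset] are irrelevant. *)
Record wgraph (T : finType) (R : Type) := WGraph {
  vset : {set T};
  eset : {set {set T}};
  wt : {set T} -> R;
  eset_edge : forall f, f \in eset -> f \subset vset /\ #|f| = 2%N
}.

Section Graphs.
Variables (T : finType) (R : comNzRingType).
Implicit Types (G : wgraph T R) (S : {set T}) (mu nu : {set {set T}}).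

Lemma del_vertices_edge G S f :
  f \in [set f in eset G | [disjoint f & S]] ->
  f \subset vset G :\: S /\ #|f| = 2%N.
Proof.
rewrite inE => /andP[fE fS]; have [fV f2] := eset_edge fE.
by rewrite subsetD fV fS.
Qed.

Definition del_vertices G S : wgraph T R :=
  WGraph (wt G) (@del_vertices_edge G S).

Definition perfect_matching G mu : bool :=
  (mu \subset eset G) &&
  [forall v in vset G, #|[set f in mu | v \in f]| == 1%N].

Definition M G : R :=
  \sum_(mu : {set {set T}} | perfect_matching G mu) \prod_(f in mu) wt G f.

(* [x :: p] lists the vertices of a path from [x] to [y], without repeated
   vertices, all of whose edges lie in the superposition of [mu] and [nu]; its
   length, counted in edges, is [size p]. *)
Definition superposition_path mu nu (x y : T) (p : seq T) : bool :=
  [&& path (fun u v => [set u; v] \in mu :|: nu) x p,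
      last x p == y & uniq (x :: p)].

End Graphs.

(* Main.v *)
Require Import Defs.
From mathcomp Require Import all_boot all_order all_algebra.

Set Implicit Arguments.
Unset Strict Implicit.
Unset Printing Implicit Defensive.

Import GRing.Theory.
Local Open Scope ring_scope.

(** Superpose a perfect matching of [G \ S] with one of [G \ (K \ S)], where
    [K = {a, b, c, d}]: vertices of [K] have degree one and all others have
    degree one or two, so the component of a vertex of [K] is a path meeting
    [K] exactly in its two ends. Exchanging the two matchings inside the
    component [C] of [a] is a weight-preserving involution that replaces [S] by
    its symmetric difference with [C :&: K]. Starting from [S = set0] it lands
    in [S = {a, x}], where [x] is the other end of the path from [a].
    Conversely, for [S = {a, x}] the ends of a path of odd length are both in
    [S] or both outside [S], so the parity hypothesis forces the path from [a]
    to end at [x], and exchanging leads back to [S = set0]. *)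

(** * Components of graphs of maximal degree two *)

Section DegreeTwo.

Context {T : finType} {e : rel T}.
Hypothesis e_sym : symmetric e.

Lemma mem_path_ends_or_inner (x z : T) (p : seq T) :
  path e x p -> uniq (x :: p) -> z \in x :: p ->
  [\/ z = x, z = last x p |
      exists u v, [/\ u != v, e z u, e z v, u \in x :: p & v \in x :: p]].
Proof.
move=> xp Up; rewrite inE => /orP[/eqP-> | zp]; first by constructor 1.
case/splitPr: zp xp Up => p1 [|v p2] xp Up.
  by constructor 2; rewrite last_cat.
constructor 3; exists (last x p1), v.
move: xp; rewrite cat_path /= => /and4P[_ e1 e2 _].
have l1 : last x p1 \in x :: p1 by apply: mem_last.
have v2 : v \in z :: v :: p2 by rewrite !inE eqxx orbT.
move: Up; rewrite -cat_cons cat_uniq => /and3P[_ /hasPn H _].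
split=> //.
- by apply: contraNneq (H v v2) => <-.
- by rewrite e_sym.
- by rewrite mem_cat l1.
- by rewrite mem_cat v2 orbT.
Qed.

Hypothesis e_deg2 :
  forall u v1 v2 v3, e u v1 -> e u v2 -> e u v3 -> v1 != v2 ->
  v3 = v1 \/ v3 = v2.

(** At most one neighbour; an isolated vertex also qualifies. *)
Definition leaf (u : T) := forall v w, e u v -> e u w -> v = w.

(** The path is closed under adjacency: the only neighbour of an end is the next vertex of the path,
    and an inner vertex already has its two neighbours on it. *)
Lemma component_path_between_leaves (x y : T) (p : seq T) :
  leaf x -> leaf y -> x != y ->
  path e x p -> last x p = y -> uniq (x :: p) ->
  [set z | connect e x z] =i x :: p.
Proof.
move=> lx ly xy xp lp Up z; rewrite inE.
have clp : closed e [in x :: p].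
  apply: intro_closed; first exact: sym_connect_sym.
  move=> u v uv up.
  have [ux | uy | [v1 [v2 [n12 e1 e2 p1 p2]]]] :=
    mem_path_ends_or_inner xp Up up.
  - case: p xp lp {Up up} => [|w p] /=; first
      by move=> _ E; rewrite E eqxx in xy.
    move=> /andP[xw _] _; rewrite ux in uv.
    by rewrite (lx _ _ uv xw) !inE eqxx orbT.
  - case/lastP: p xp lp uy {Up up} => [|p w] /=.
      by move=> _ E; rewrite E eqxx in xy.
    rewrite rcons_path last_rcons => /andP[_ wl] wy uw.
    have -> : v = last x p.
      by apply: ly; [rewrite -wy -uw | rewrite -wy e_sym].
    by rewrite -rcons_cons mem_rcons inE mem_last orbT.
  - by have [->|->] := e_deg2 e1 e2 uv n12.
apply/idP/idP => [xz | zp]; last exact: (path_connect xp).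
by rewrite -(closed_connect clp xz) inE eqxx.
Qed.

(** A third leaf in the component would be an inner vertex of the path from [x] to [y], hence have
    two distinct neighbours. *)
Lemma leaf_component (x y z : T) :
  leaf x -> leaf y -> leaf z -> x != y ->
  connect e x y -> connect e x z -> z = x \/ z = y.
Proof.
move=> lx ly lz xy /connectP[p0 xp0 y0] xz.
case/shortenP: xp0 y0 => p xp Up _ yE.
have zp : z \in x :: p.
  by rewrite -(component_path_between_leaves lx ly xy xp (esym yE) Up) inE.
have [-> | -> | [u [v [/eqP uv zu zv _ _]]]] := mem_path_ends_or_inner xp Up zp.
- by left.
- by right.
- by case: uv; apply: lz.
Qed.

End DegreeTwo.

(** * Exchanging two matchings inside a vertex set *)

Section Exchange.

Context {T : finType} {R : comNzRingType}.
Variable G : wgraph T R.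
Implicit Types (S C K : {set T}) (mu nu : {set {set T}}).
Implicit Types (q : {set {set T}} * {set {set T}}).

Lemma perfect_matchingP S mu :
  reflect [/\ forall f, f \in mu -> f \in eset G /\ [disjoint f & S],
              forall v, v \in vset G :\: S -> exists2 f, f \in mu & v \in f
            & forall v f g, f \in mu -> g \in mu -> v \in f -> v \in g -> f = g]
          (perfect_matching (del_vertices G S) mu).
Proof.
apply: (iffP andP) => [[/subsetP sE /forall_inP H]|[H1 H2 H3]].
  have H1 f : f \in mu -> f \in eset G /\ [disjoint f & S].
    by move/sE; rewrite inE => /andP.
  split=> // [v /H /cards1P[f E]|v f g fm gm vf vg].
    by have: f \in [set f] by [rewrite inE]; rewrite -E inE => /andP[]; exists f.
  have vV : v \in vset G :\: S.
    have [/eset_edge[/subsetP fV _] fS] := H1 _ fm.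
    by rewrite inE (fV _ vf) (disjointFr fS vf).
  have /cards1P[h E] := H v vV.
  have : f \in [set h] by rewrite -E inE fm.
  have : g \in [set h] by rewrite -E inE gm.
  by rewrite !inE => /eqP-> /eqP->.
split.
  by apply/subsetP => f /H1[fE fS]; rewrite inE fE.
apply/forall_inP => v /H2[f fm vf]; apply/cards1P; exists f.
apply/setP => g; rewrite !inE; apply/andP/eqP => [[gm vg]|->//].
exact: (H3 v).
Qed.

Definition exchange C mu nu : {set {set T}} :=
  [set f : {set T} | if f \subset C then f \in nu else f \in mu].

(** No edge of [mu] crosses the boundary of [C], so testing [f \subset C] in [exchange] amounts to
    testing any single vertex of [f]. *)
Definition saturated C mu :=
  forall f u v, f \in mu -> u \in f -> v \in f -> u \in C -> v \in C.

Lemma saturated_subset C mu f u :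
  saturated C mu -> f \in mu -> u \in f -> (f \subset C) = (u \in C).
Proof.
move=> sat fm uf; apply/subsetP/idP => [fC|uC v vf]; first exact: fC.
exact: (sat f u).
Qed.

(** At a vertex of [C] the new matching looks like [nu], elsewhere like [mu]; hence the deleted
    vertices are those of [S'] inside [C] and those of [S] outside. *)
Lemma perfect_matching_exchange S S' C mu nu :
  perfect_matching (del_vertices G S) mu ->
  perfect_matching (del_vertices G S') nu ->
  saturated C mu -> saturated C nu ->
  perfect_matching (del_vertices G ((S :\: C) :|: (S' :&: C)))
    (exchange C mu nu).
Proof.
move=> /perfect_matchingP[m1 m2 m3] /perfect_matchingP[n1 n2 n3] sm sn.
have exE f v : f \in exchange C mu nu -> v \in f ->
    if v \in C then f \in nu else f \in mu.
  rewrite inE; case: ifPn => [/subsetP fC fn vf | fC fm vf].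
    by rewrite fC.
  by rewrite -(saturated_subset sm fm vf) (negPf fC).
apply/perfect_matchingP; split=> [f fx|v|v f g fx gx vf vg].
- split; first by move: fx; rewrite inE; case: ifP => _ => [/n1[]|/m1[]].
  apply/pred0P => v /=; apply/negbTE/negP => /andP[vf].
  have := exE _ _ fx vf; rewrite !inE; case: (v \in C) => /=.
    by move/n1=> [_ /disjointFr fS]; rewrite andbT fS.
  by move/m1=> [_ /disjointFr fS]; rewrite andbF orbF fS.
- rewrite !inE; case vC: (v \in C); rewrite /= ?andbT ?andbF ?orbF => vV.
    have [|f fn vf] := n2 v; first by rewrite inE.
    by exists f => //; rewrite inE (saturated_subset sn fn vf) vC.
  have [|f fn vf] := m2 v; first by rewrite inE.
  by exists f => //; rewrite inE (saturated_subset sm fn vf) vC.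
- move: (exE _ _ fx vf) (exE _ _ gx vg); case: ifP => _ ? ?.
    exact: (n3 v).
  exact: (m3 v).
Qed.

(** The edges of [mu] contained in [C] partition [C :\: S] into pairs. *)
Lemma even_card_saturated S C mu :
  perfect_matching (del_vertices G S) mu -> saturated C mu ->
  C \subset vset G -> ~~ odd #|C :\: S|.
Proof.
move=> /perfect_matchingP[m1 m2 m3] sat /subsetP CV.
have part : partition [set f in mu | f \subset C] (C :\: S).
  apply/and3P; split.
  - apply/eqP/setP => v; rewrite inE; apply/bigcupP/andP.
      move=> [f]; rewrite inE => /andP[fm /subsetP fC] vf.
      by rewrite fC // (disjointFr (m1 _ fm).2 vf).
    move=> [vS vC]; have [|f fm vf] := m2 v; first by rewrite inE vS CV.
    by exists f => //; rewrite inE fm (saturated_subset sat fm vf).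
  - apply/trivIsetP => f g; rewrite !inE => /andP[fm _] /andP[gm _] /eqP fg.
    apply/pred0P => v /=; apply/negbTE/negP => /andP[vf vg].
    by apply: fg; apply: (m3 v).
  - apply/negP; rewrite inE => /andP[/m1[/eset_edge[_]]].
    by rewrite cards0.
rewrite (card_uniform_partition _ part (n := 2)); first by rewrite oddM andbF.
by move=> f; rewrite inE => /andP[/m1[/eset_edge[_ ->]]].
Qed.

(** The union forgets multiplicity: an edge common to both matchings is a single edge here, so its
    ends have degree one. *)
Definition superposed q : rel T := fun u v => [set u; v] \in q.1 :|: q.2.

Lemma superposed_sym q : symmetric (superposed q).
Proof. by move=> u v; rewrite /superposed setUC. Qed.

Definition component (a : T) q : {set T} := [set v | connect (superposed q) a v].

Definition exchange_at (a : T) q :=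
  (exchange (component a q) q.1 q.2, exchange (component a q) q.2 q.1).

(** Each edge either stays in its matching or moves to the other one, so the superposition is
    unchanged. This makes the exchange an involution. *)
Lemma component_exchange_at a q : component a (exchange_at a q) = component a q.
Proof.
apply/setP => v; rewrite !inE; apply: eq_connect => x y.
rewrite /superposed /exchange_at !inE.
by case: ifP => // _; rewrite orbC.
Qed.

Lemma exchange_atK a : involutive (exchange_at a).
Proof.
move=> q; rewrite {1}/exchange_at component_exchange_at [RHS]surjective_pairing.
by congr pair; apply/setP => f; rewrite !inE; case: ifP => ->.
Qed.

Lemma prod_exchange_at a q (F : {set T} -> R) :
  (\prod_(f in (exchange_at a q).1) F f) * (\prod_(f in (exchange_at a q).2) F f)
  = (\prod_(f in q.1) F f) * (\prod_(f in q.2) F f).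
Proof.
have prodE (A : {set {set T}}) :
    \prod_(f in A) F f = \prod_f (if f \in A then F f else 1).
  exact: big_mkcond.
rewrite !prodE -!big_split /=.
by apply: eq_bigr => f _; rewrite !inE; case: (f \subset _); rewrite // mulrC.
Qed.

Definition matching_pair K S q :=
  perfect_matching (del_vertices G S) q.1 &&
  perfect_matching (del_vertices G (K :\: S)) q.2.

Lemma sum_matching_pair K S :
  M (del_vertices G S) * M (del_vertices G (K :\: S)) =
  \sum_(q | matching_pair K S q)
    (\prod_(f in q.1) wt G f) * (\prod_(f in q.2) wt G f).
Proof. by rewrite /M big_distrlr /= pair_big. Qed.

(** * Structure of the superposition of a pair of matchings *)

Section MatchingPair.

Variables (K S : {set T}) (q : {set {set T}} * {set {set T}}).
Hypotheses (KV : K \subset vset G) (SK : S \subset K).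
Hypothesis qP : matching_pair K S q.

Lemma matching_pair_edge f : f \in q.1 :|: q.2 -> f \in eset G.
Proof.
have /andP[/perfect_matchingP[m1 _ _] /perfect_matchingP[n1 _ _]] := qP.
by rewrite inE => /orP[/m1[]|/n1[]].
Qed.

Lemma superposed_neq u v : superposed q u v -> u != v.
Proof.
by move=> /matching_pair_edge/eset_edge[_]; rewrite cards2; case: eqP.
Qed.

Lemma superposed_inj u v w :
  superposed q u v -> superposed q u w -> [set u; v] = [set u; w] -> v = w.
Proof.
move=> /superposed_neq uv _ /setP/(_ v).
by rewrite !inE eqxx orbT eq_sym (negPf uv) => /esym/eqP.
Qed.

(** Pigeonhole: of three edges at [u], two lie in the same matching and therefore coincide. *)
Lemma superposed_deg2 u v1 v2 v3 :
  superposed q u v1 -> superposed q u v2 -> superposed q u v3 -> v1 != v2 ->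
  v3 = v1 \/ v3 = v2.
Proof.
move=> e1 e2 e3 /eqP n12.
have /andP[/perfect_matchingP[_ _ m3] /perfect_matchingP[_ _ n3]] := qP.
have uin w : u \in [set u; w] by rewrite !inE eqxx.
have eqm v w : superposed q u v -> superposed q u w ->
    [set u; v] \in q.1 -> [set u; w] \in q.1 -> v = w.
  by move=> ev ew ? ?; apply: (superposed_inj ev ew); apply: (m3 u).
have eqn v w : superposed q u v -> superposed q u w ->
    [set u; v] \in q.2 -> [set u; w] \in q.2 -> v = w.
  by move=> ev ew ? ?; apply: (superposed_inj ev ew); apply: (n3 u).
have := e1; have := e2; have := e3; rewrite /superposed !inE.
case/orP=> h3; case/orP=> h2; case/orP=> h1;
  by [case: n12; apply: eqm | case: n12; apply: eqn
     |left; apply: eqm | left; apply: eqn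
     |right; apply: eqm | right; apply: eqn].
Qed.

(** A vertex of [K] is deleted from exactly one of the two graphs, so only the other matching has an
    edge there. *)
Lemma leaf_superposed u : u \in K -> leaf (e := superposed q) u.
Proof.
move=> uK v w ev ew.
have /andP[/perfect_matchingP[m1 _ m3] /perfect_matchingP[n1 _ n3]] := qP.
have uin t : u \in [set u; t] by rewrite !inE eqxx.
apply: (superposed_inj ev ew); move: ev ew; rewrite /superposed !inE.
case uS: (u \in S).
  have no t : [set u; t] \in q.1 = false.
    by apply/negP => /m1[_ /disjointFr/(_ (uin t))]; rewrite uS.
  by rewrite !no /= => ? ?; apply: (n3 u).
have no t : [set u; t] \in q.2 = false.
  by apply/negP => /n1[_ /disjointFr/(_ (uin t))]; rewrite inE uS uK.
by rewrite !no !orbF => ? ?; apply: (m3 u).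
Qed.

Lemma component_saturated t : saturated (component t q) (q.1 :|: q.2).
Proof.
move=> f u v fq uf vf; rewrite !inE => tu; apply: (connect_trans tu).
have [->|uv] := eqVneq u v; first exact: connect0.
apply: connect1; rewrite /superposed.
suff -> : [set u; v] = f by [].
apply/eqP; rewrite eqEcard cards2 uv (eset_edge (matching_pair_edge fq)).2.
by rewrite leqnn andbT; apply/subsetP => w; rewrite !inE => /orP[]/eqP->.
Qed.

Lemma component_saturated1 t : saturated (component t q) q.1.
Proof.
by move=> f u v fq; apply: (@component_saturated t f); rewrite inE fq.
Qed.

Lemma component_saturated2 t : saturated (component t q) q.2.
Proof.
by move=> f u v fq; apply: (@component_saturated t f); rewrite inE fq orbT.
Qed.

Lemma component_subset t : t \in vset G -> component t q \subset vset G.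
Proof.
move=> tV.
have cl : closed (superposed q) [in vset G].
  apply: intro_closed; first exact: sym_connect_sym (superposed_sym q).
  move=> u v /matching_pair_edge/eset_edge[/subsetP sV _] _.
  by apply: sV; rewrite !inE eqxx orbT.
apply/subsetP => v; rewrite inE => tv.
by rewrite -(closed_connect cl tv).
Qed.

Lemma matching_pair_exchange_at a :
  matching_pair K ((S :\: component a q) :|: ((K :\: S) :&: component a q))
    (exchange_at a q).
Proof.
have /andP[m n] := qP.
have sm := @component_saturated1 a; have sn := @component_saturated2 a.
apply/andP; split; first exact: perfect_matching_exchange.
have := perfect_matching_exchange n m sn sm.
congr (is_true (perfect_matching (del_vertices G _) _)).
(* The second deleted set is the complement in [K] of the first, checked pointwise. *)
move: (component a q) => C; apply/setP => v; rewrite !inE.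
have := subsetP SK v.
by case: (v \in S) => [->//|_]; case: (v \in C); case: (v \in K).
Qed.

Lemma odd_component t : t \in K ->
  odd #|component t q| = odd #|component t q :&: S|.
Proof.
move=> tK; have /andP[m _] := qP.
rewrite -(cardsID S (component t q)) oddD.
rewrite (negPf (even_card_saturated m (@component_saturated1 t) _)) ?addbF //.
exact: component_subset (subsetP KV t tK).
Qed.

(** For [C] the component, [C :\: S] and [C :\: (K :\: S)] are both even, so [C :&: S] and
    [C :&: (K :\: S)] both have the parity of [C], and their sizes add up to an even number. *)
Lemma even_component_terminals t : t \in K -> ~~ odd #|component t q :&: K|.
Proof.
move=> tK; have /andP[_ n] := qP.
have CV := component_subset (subsetP KV t tK).
have := even_card_saturated n (@component_saturated2 t) CV.
have := odd_component tK.
have -> : component t q :&: S = component t q :&: K :&: S.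
  by rewrite -setIA (setIidPr SK).
rewrite -[X in odd X = _](cardsID (K :\: S)) -(cardsID S (_ :&: K)) !oddD.
by rewrite setIDA => /[swap] /negPf->; rewrite addbF => ->; rewrite addbb.
Qed.

(** Parity yields a second terminal [y] beside [t]. Both are leaves, so the path between them fills
    the component and leaves no room for a third terminal. *)
Lemma component_terminals t : t \in K ->
  exists y p, [/\ y \in K, y != t, component t q :&: K = [set t; y],
    superposition_path q.1 q.2 t y p & #|component t q| = (size p).+1].
Proof.
move=> tK.
have tC : t \in component t q by rewrite inE connect0.
have [y /setD1P[yt /setIP[yC yK]]] : exists y, y \in (component t q :&: K) :\ t.
  apply/set0Pn; rewrite -card_gt0; have := even_component_terminals tK.
  by rewrite (cardsD1 t) inE tC tK /=; case: #|_|.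
move: (yC); rewrite inE => /[dup] ty /connectP[p0 tp0 y0].
case/shortenP: tp0 y0 => p tp Up _ yE.
have lt := leaf_superposed tK; have ly := leaf_superposed yK.
have ty' : t != y by rewrite eq_sym.
exists y, p; split=> //.
- apply/setP => z; rewrite !inE; apply/andP/orP => [[tz zK]|].
    have lz := leaf_superposed zK.
    have [->|->] := leaf_component (superposed_sym q) superposed_deg2
      lt ly lz ty' ty tz; by [left | right].
  by case=> /eqP->; rewrite ?connect0.
- by apply/and3P; split; [exact: tp | rewrite -yE | exact: Up].
- rewrite -[RHS]/(size (t :: p)) -(card_uniqP Up); apply: eq_card.
  exact: (component_path_between_leaves (superposed_sym q) superposed_deg2
    lt ly ty' tp (esym yE) Up).
Qed.

End MatchingPair.

End Exchange.

(** * The four terminals and the pairing of [a] *)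

Section Condensation.

Context {T : finType} {R : comNzRingType}.
Variables (G : wgraph T R) (a b c d : T).
Hypothesis Hdistinct : uniq [:: a; b; c; d].
Let K := [set a; b; c; d].
Hypothesis KV : K \subset vset G.

Lemma set2_eq_right (u v w : T) : v != u -> ([set u; v] == [set u; w]) = (v == w).
Proof.
move=> vu; apply/eqP/eqP => [/setP/(_ v)|->//].
by rewrite !inE eqxx orbT (negPf vu) /= => /esym/eqP.
Qed.

Lemma setI_set2 (u v w : T) : v != w -> [set u; v] :&: [set u; w] = [set u].
Proof.
move=> vw; rewrite -setUIr; suff -> : [set v] :&: [set w] = set0 by rewrite setU0.
apply/setP => z; rewrite !inE; apply: contraNF vw.
by move=> /andP[/eqP<- /eqP<-].
Qed.

Lemma pair_sub_terminals x : x \in [:: b; c; d] -> [set a; x] \subset K.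
Proof.
rewrite !inE => xP; apply/subsetP => v; rewrite !inE -!orbA.
by case/orP=> /eqP->; rewrite ?eqxx // xP orbT.
Qed.

Lemma neq_a x : x \in [:: b; c; d] -> x != a.
Proof. by move: Hdistinct => /andP[aN _] xP; apply: contraNneq aN => <-. Qed.

Lemma mem_terminals_neq_a y : y \in K -> y != a -> y \in [:: b; c; d].
Proof. by rewrite !inE -!orbA => /orP[->|]. Qed.

Section OddPaths.

Implicit Types (S : {set T}) (q : {set {set T}} * {set {set T}}) (t x y : T).

Hypothesis Hodd : forall S : {set T},
  S \subset K -> #|S| = 2%N ->
  forall mu nu : {set {set T}},
  perfect_matching (del_vertices G S) mu ->
  perfect_matching (del_vertices G (K :\: S)) nu ->
  forall (x y : T) (p : seq T),
  (x, y) \in [:: (a, b); (a, c); (b, c)] ->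
  superposition_path mu nu x y p -> odd (size p).

(** An odd path has an even number of vertices; all of them outside [S] are paired by the first
    matching, so an even number lie in [S], and those can only be the ends. *)
Lemma odd_path_terminals S q t y : S \subset K -> #|S| = 2%N ->
  matching_pair G K S q -> t \in K -> y != t ->
  component t q :&: K = [set t; y] -> (t, y) \in [:: (a, b); (a, c); (b, c)] ->
  ~~ odd #|[set t; y] :&: S|.
Proof.
move=> SK S2 qP tK yt Cty tyP.
have [y' [p [_ y't Cty' pP sizep]]] := component_terminals KV SK qP tK.
have yy : y' = y.
  by apply/eqP; rewrite -(set2_eq_right _ y't) -Cty' -Cty.
rewrite yy in pP; have /andP[m n] := qP.
have := odd_component KV qP tK; rewrite sizep /= (Hodd SK S2 m n tyP pP) /=.
by rewrite -Cty -setIA (setIidPr SK) => <-.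
Qed.

(** If the path from [a] ended at some [y] other than [x], parity would exclude [b] and [c], leaving
    [y = d]. Then [b] and [c] are joined by a path, of which exactly one end, [x], is in [S]: again
    a parity contradiction. *)
Lemma component_of_pair x q : x \in [:: b; c; d] ->
  matching_pair G K [set a; x] q -> component a q :&: K = [set a; x].
Proof.
move=> xP qP; have xa := neq_a xP; have SK := pair_sub_terminals xP.
have S2 : #|[set a; x]| = 2%N by rewrite cards2 eq_sym xa.
have aK : a \in K by rewrite !inE eqxx.
have bK : b \in K by rewrite !inE eqxx orbT.
have [y [_ [yK ya Cay _ _]]] := component_terminals KV SK qP aK.
have [<- //|yx] := eqVneq y x.
(* Here [[set a; y]] meets [[set a; x]] in [a] alone, an odd number. *)
have Nbc : ~~ ((a, y) \in [:: (a, b); (a, c); (b, c)]).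
  apply/negP => /(odd_path_terminals SK S2 qP aK ya Cay).
  by rewrite setI_set2 // cards1.
have yd : y = d.
  have := mem_terminals_neq_a yK ya; move: Nbc.
  by rewrite !inE !xpair_eqE eqxx /= !negb_or => /and3P[/negPf-> /negPf-> _] /eqP.
rewrite {y yK ya Nbc}yd in Cay yx.
move: Hdistinct; rewrite /= !inE !negb_or -!andbA.
case/and5P=> ab ac ad bc /and3P[bd cd _].
have [y [_ [yK yb Cby _ _]]] := component_terminals KV SK qP bK.
have NbC : b \notin component a q.
  apply/negP => bC; have : b \in component a q :&: K by rewrite inE bC.
  by rewrite Cay !inE eq_sym (negPf ab) (negPf bd).
(* The components of [a] and [b] are disjoint, so the path from [b] can end neither at [a] nor at
   [d]. *)
have disj z : z \in component b q -> z \notin component a q.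
  rewrite !inE => bz; apply: contra NbC => az; rewrite inE.
  by apply: (connect_trans az); rewrite sym_connect_sym //; apply: superposed_sym.
have yC : y \in component b q.
  have : y \in component b q :&: K by rewrite Cby !inE eqxx orbT.
  by case/setIP.
have aC : a \in component a q by rewrite inE connect0.
have dC : d \in component a q.
  have : d \in component a q :&: K by rewrite Cay !inE eqxx orbT.
  by case/setIP.
have yc : y = c.
  have ya : y != a by apply: contraNneq (disj y yC) => ->.
  have yd : y != d by apply: contraNneq (disj y yC) => ->.
  have := mem_terminals_neq_a yK ya.
  by rewrite !inE (negPf yb) (negPf yd) orbF => /eqP.
rewrite {y yK yC}yc in yb Cby.
have := odd_path_terminals SK S2 qP bK yb Cby.
rewrite !inE eqxx !orbT => /(_ isT).
suff -> : [set b; c] :&: [set a; x] = [set x] by rewrite cards1.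
move: xP; rewrite !inE [x == d]eq_sym (negPf yx) orbF.
case/orP=> /eqP->.
  by rewrite [[set a; b]]setUC setI_set2 // eq_sym.
by rewrite [[set b; c]]setUC [[set a; c]]setUC setI_set2 // eq_sym.
Qed.

End OddPaths.

(** Reindexing by the exchange at [a] preserves weights and swaps the deleted sets [[set a; x]] and
    [set0]; the component of [a] is kept, which identifies the image. *)
Lemma sum_pair_condensation x : x \in [:: b; c; d] ->
  (forall q, matching_pair G K [set a; x] q ->
     component a q :&: K = [set a; x]) ->
  M (del_vertices G [set a; x]) * M (del_vertices G (K :\: [set a; x])) =
  \sum_(q | matching_pair G K set0 q && (component a q :&: K == [set a; x]))
    (\prod_(f in q.1) wt G f) * (\prod_(f in q.2) wt G f).
Proof.
move=> xP HC; have SK := pair_sub_terminals xP.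
rewrite sum_matching_pair (reindex_inj (inv_inj (exchange_atK a))) /=.
apply: eq_big => q; last by rewrite prod_exchange_at.
(* Stated for a general [S'] to serve both directions: the new deleted set is the symmetric
   difference of [S'] and [[set a; x]]. *)
have toggle (S' : {set T}) (q' : {set {set T}} * {set {set T}}) :
    S' \subset K -> matching_pair G K S' q' ->
    component a q' :&: K = [set a; x] ->
    matching_pair G K ((S' :\: [set a; x]) :|: ([set a; x] :\: S'))
      (exchange_at a q').
  move=> S'K q'P <-; have := matching_pair_exchange_at S'K q'P a.
  congr (is_true (matching_pair _ _ _ _)).
  move: (component a q') (K) S'K => C L /subsetP SL.
  apply/setP => v; rewrite !inE; have := SL v.
  by case: (v \in S') => [->//|_]; case: (v \in C); case: (v \in L).
apply/idP/andP => [qP|[qP /eqP CE]].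
  have CE := HC _ qP; split.
    have := toggle _ _ SK qP CE.
    by rewrite setDv setU0 exchange_atK.
  by rewrite -(component_exchange_at a q) CE.
by have := toggle _ _ (sub0set _) qP CE; rewrite set0D set0U setD0.
Qed.

End Condensation.

(** * The condensation identity *)

Theorem theorem1 (R : comNzRingType) (T : finType) (G : wgraph T R)
  (a b c d : T)
  (Hdistinct : uniq [:: a; b; c; d])
  (HV : [set a; b; c; d] \subset vset G)
  (Hodd : forall S : {set T},
     S \subset [set a; b; c; d] -> #|S| = 2%N ->
     forall mu nu : {set {set T}},
     perfect_matching (del_vertices G S) mu ->
     perfect_matching (del_vertices G ([set a; b; c; d] :\: S)) nu ->
     forall (x y : T) (p : seq T),
     (x, y) \in [:: (a, b); (a, c); (b, c)] ->
     superposition_path mu nu x y p -> odd (size p)) :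
  M G * M (del_vertices G [set a; b; c; d]) =
    M (del_vertices G [set a; b]) * M (del_vertices G [set c; d])
  + M (del_vertices G [set a; c]) * M (del_vertices G [set b; d])
  + M (del_vertices G [set a; d]) * M (del_vertices G [set b; c]).
Proof.
set K := [set a; b; c; d] in HV Hodd *.
have HC x : x \in [:: b; c; d] -> forall q, matching_pair G K [set a; x] q ->
    component a q :&: K = [set a; x].
  by move=> xP q; apply: component_of_pair.
have M0 : M G = M (del_vertices G set0).
  rewrite /M; apply: eq_bigl => mu; rewrite /perfect_matching /= setD0.
  suff -> : [set f in eset G | [disjoint f & set0]] = eset G by [].
  by apply/setP => f; rewrite inE disjoints_subset setC0 subsetT andbT.
have KD (L : {set T}) x y z w :
    uniq [:: x; y; z; w] -> L =i [:: x; y; z; w] -> [set z; w] = L :\: [set x; y].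
  move=> /=; rewrite !inE !negb_or -!andbA => /and5P[_ xz xw yz /and3P[yw _ _]] LE.
  apply/setP => v; rewrite in_setD LE !inE negb_or.
  have [->|_] := eqVneq v x; first by rewrite (negPf xz) (negPf xw).
  by have [->|_] := eqVneq v y; first by rewrite (negPf yz) (negPf yw).
move: (Hdistinct); rewrite /= !inE !negb_or -!andbA.
case/and5P=> ab ac ad bc /and3P[bd cd _].
have mb : b \in [:: b; c; d] by rewrite !inE eqxx.
have mc : c \in [:: b; c; d] by rewrite !inE eqxx orbT.
have md : d \in [:: b; c; d] by rewrite !inE eqxx !orbT.
have KE p : perm_eq p [:: a; b; c; d] -> K =i p.
  by move=> /perm_mem pE v; rewrite pE !inE -!orbA.
have -> := KD K a b c d Hdistinct (KE _ (perm_refl _)).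
have pc : perm_eq [:: a; c; b; d] [:: a; b; c; d].
  by rewrite perm_cons (perm_catCA [:: c] [:: b] [:: d]).
have pd : perm_eq [:: a; d; b; c] [:: a; b; c; d].
  by rewrite perm_cons (perm_catC [:: d] [:: b; c]).
have -> : [set b; d] = K :\: [set a; c].
  by apply: KD; [rewrite (perm_uniq pc) | apply: KE].
have -> : [set b; c] = K :\: [set a; d].
  by apply: KD; [rewrite (perm_uniq pd) | apply: KE].
rewrite M0 -[in LHS](setD0 K) sum_matching_pair.
rewrite (sum_pair_condensation mb (HC b mb)).
rewrite (sum_pair_condensation mc (HC c mc)).
rewrite (sum_pair_condensation md (HC d md)).
(* All sums now run over the pairs for [set0], with the condition on the component of [a] turned
   into an indicator; they are compared term by term. *)
rewrite !(big_mkcondr _ _ (matching_pair G K set0)) -!big_split /=.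
apply: eq_bigr => q qP.
have aK : a \in K by rewrite !inE eqxx.
(* The path from [a] ends at exactly one of [b], [c], [d], so exactly one of the three indicators is
   nonzero. *)
have [y [_ [yK ya -> _ _]]] := component_terminals HV (sub0set K) qP aK.
rewrite !(set2_eq_right _ ya).
have := mem_terminals_neq_a yK ya; rewrite !inE.
case/or3P=> /eqP->; rewrite eqxx.
- by rewrite (negPf bc) (negPf bd) !addr0.
- by rewrite eq_sym (negPf bc) (negPf cd) addr0 add0r.
- by rewrite [d == b]eq_sym [d == c]eq_sym (negPf bd) (negPf cd) !add0r.
Qed.
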